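(* For all $n,k \in \mathbb{Z}^+$ with $k \leq \binom{n}{2}$, there exists a universal cycle for $\mathcal{W}_k^-(n)$.
   Context: $\mathcal{W}(n)$ denotes the set of weak orders on $[n]$ (transitive and complete relations), represented as words: $\mathcal{W}(n)$ is the set of all words $w_1w_2\ldots w_n$ of length $n$ over the nonnegative integers such that $\{w_1,\dots,w_n\} = \{0,1,\dots,h\}$ for some $h$ with $0 \le h \le n-1$ (here $w_j$ is the height of element $j$ in the weak order). The weight of $w = w_1\ldots w_n$ is $\sum_{i=1}^n w_i$, and $\mathcal{W}_k(n)$ is the set of $w \in \mathcal{W}(n)$ of weight $k$. The prefix of $w = w_1\ldots w_n$ is $w^- = w_1w_2\ldots w_{n-1}$, and $\mathcal{W}_k^-(n) = \{w^- \mid w \in \mathcal{W}_k(n)\}$, a set of strings of length $n-1$. Let $\mathcal{C}$ be a set of $N$ strings, each of length $m$. A universal cycle (ucycle) for $\mathcal{C}$ is a word $a_0a_1\ldots a_{N-1}$ such that each $c \in \mathcal{C}$ appears exactly once as a subword $a_{i+1}a_{i+2}\ldots a_{i+m}$ (one value of $i$ modulo $N$), where subscripts are taken modulo $N$. (In particular every such subword is a string in $\mathcal{C}$.) *)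

(* Defs.v *)
From mathcomp Require Import all_boot.
From mathcomp Require Import boolp classical_sets functions cardinality.

Set Implicit Arguments.
Unset Strict Implicit.
Unset Printing Implicit Defensive.

Local Open Scope classical_set_scope.
Local Open Scope card_scope.

(* Letter j of w is the height of element j in the weak order: the set of
   letters must be {0, ..., h} for some h <= n - 1. *)
Definition weak_orders (n : nat) : set (seq nat) :=
  [set w | size w = n /\ exists h : nat, h < n /\ [set` w] = `I_h.+1].

Definition weight (w : seq nat) : nat := \sum_(x <- w) x.

Definition weak_orders_of_weight (n k : nat) : set (seq nat) :=
  [set w | weak_orders n w /\ weight w = k].

Definition word_prefix (w : seq nat) : seq nat := take (size w).-1 w.

Definition weak_order_prefixes (n k : nat) : set (seq nat) :=
  word_prefix @` weak_orders_of_weight n k.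

(* a_{i+1} a_{i+2} ... a_{i+m}, with subscripts modulo N = size a; the default
   letter 0 is never reached when a is nonempty. *)
Definition cyclic_subword (m : nat) (a : seq nat) (i : nat) : seq nat :=
  mkseq (fun j => nth 0 a ((i + j.+1) %% size a)) m.

(* C is intended to be a set of strings of length m. Since C has exactly as
   many elements as there are positions i, the uniqueness clause also forces
   every cyclic subword of a to lie in C. *)
Definition ucycle_for (m : nat) (C : set (seq nat)) (a : seq nat) : Prop :=
  C #= `I_(size a) /\
  forall c, C c -> exists! i, i < size a /\ cyclic_subword m a i = c.

(* Main.v *)
Require Import Defs.
From mathcomp Require Import all_boot all_fingroup zify.
From mathcomp Require Import boolp classical_sets functions cardinality.

(** Join a word w of W_k(n) to w' when w_2 .. w_{n-1} = w'_1 .. w'_{n-2}. Since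
    the weight is fixed, a word is determined by its prefix, so a ucycle is a
    cyclic ordering of W_k(n) in which consecutive words are joined. Rotation is
    a permutation sending each word to one it is joined to. Among all such
    permutations take one with the fewest cycles: if a word of one cycle
    is joined to a word of another, a transposition merges the two cycles, so
    there is only one cycle as soon as the relation is connected.
    For connectivity, rotations and overlaps permute the letters of a word
    arbitrarily and replace any two letters by others with the same sum. If a
    word of height h repeats a letter v < h - 1, replacing v, h by v + 1, h - 1
    lowers the sum of squares; the process stops at a word in which only the two
    top heights are repeated, and n and k determine such a word up to order. *)

(** * Letters of a word and their rearrangements *)

Lemma weak_orders_of_weightP {n k : nat} {w : seq nat} :
  weak_orders_of_weight n k w <->
  [/\ size w = n, weight w = k &
      exists2 h, h < n & forall v, (v \in w) = (v <= h)].
Proof.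
split=> [[[sw [h [hn E]]] ww]|[sw ww [h hn E]]].
  split=> //; exists h => // v.
  by apply/idP/idP => [vw|vh]; [have : [set` w]%classic v by []; rewrite E|
     have : (`I_h.+1)%classic v by []; rewrite -E].
split=> //; split=> //; exists h; split=> //.
by apply/seteqP; split=> v /=; rewrite E.
Qed.

(** Induction on [s] behind a common prefix [a]: the head of [s] is located in [t] and moved to the
    front past one letter at a time. *)
Lemma adjacent_swap_invariant {T : eqType} {A : Type} {Q : seq T -> A} :
  (forall a x y b, Q (a ++ x :: y :: b) = Q (a ++ y :: x :: b)) ->
  forall s t, perm_eq s t -> Q s = Q t.
Proof.
move=> Qswap s t; rewrite -[s]cat0s -[t]cat0s perm_cat2l; move: [::] => a.
elim: s t a => [|x s IHs] t a st.
  by move: st; rewrite perm_sym => /perm_nilP ->.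
have /path.splitPr xt : x \in t by rewrite -(perm_mem st) mem_head.
case: xt st => t1 t2 st.
have {}st : perm_eq s (t1 ++ t2).
  by rewrite -(perm_cons x) (perm_trans st) // perm_catC /= perm_cons perm_catC.
rewrite -cat_rcons (IHs _ (rcons a x) st) {s st IHs} cat_rcons.
elim/last_ind: t1 t2 => [|t1 y IHt] t2 //=.
by rewrite !cat_rcons IHt catA Qswap -catA.
Qed.

(** * Terminal words: only the two top heights may repeat *)

Lemma terminal_perm {h : nat} {w : seq nat} :
  (forall v, (v \in w) = (v <= h.+1)) ->
  (forall v, v < h -> count_mem v w = 1) ->
  perm_eq w (iota 0 h ++ nseq (count_mem h w) h ++
             nseq (count_mem h.+1 w) h.+1).
Proof.
move=> wE w1; apply/allP => v _ /=; rewrite !count_cat !count_nseq /=.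
rewrite (count_uniq_mem v (s := iota 0 h)) ?iota_uniq // mem_iota /=.
case: (ltngtP v h) => vh.
- by rewrite w1 //; have -> : (h.+1 == v) = false by lia.
- have [->|vh1] := eqVneq v h.+1; first lia.
  by rewrite (count_memPn _) ?wE //; lia.
- by rewrite -vh; (have -> : (v.+1 == v) = false by lia); rewrite mul1n addn0.
Qed.

Lemma double_sum_iota (h : nat) : 2 * \sum_(x <- iota 0 h) x = h * h.-1.
Proof.
elim: h => [|h IHh]; first by rewrite big_nil.
rewrite -(addn1 h) iotaD big_cat /= big_seq1 mulnDr IHh.
by case: h {IHh} => [|h] //=; lia.
Qed.

(** If h < h', the second sorted word is at least the first letter by letter, and strictly larger at
    its last letter h' + 1, so at equal size its weight would be larger. Sums are doubled to avoid
    halves. *)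
Lemma terminal_height_le {h h' p p' q q' : nat} :
  0 < p -> 0 < q' -> 0 < p' ->
  size (iota 0 h ++ nseq p h ++ nseq q h.+1) =
    size (iota 0 h' ++ nseq p' h' ++ nseq q' h'.+1) ->
  weight (iota 0 h ++ nseq p h ++ nseq q h.+1) =
    weight (iota 0 h' ++ nseq p' h' ++ nseq q' h'.+1) ->
  h' <= h.
Proof.
move=> p0 q'0 p'0; rewrite /weight !size_cat !size_iota !size_nseq.
rewrite !big_cat /= !big_nseq !iter_addn_0.
have := double_sum_iota h; have := double_sum_iota h'.
move: (\sum_(x <- _) _) (\sum_(x <- _) _) => S S' S'E SE szE wE.
rewrite leqNgt; apply/negP => hh'.
have [d h'E] : exists d, h' = h + d.+1 by exists (h' - h.+1); lia.
subst h'; have {}S'E : 2 * S' = (h + d) * (h + d.+1) by rewrite S'E addnS mulnC.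
have {}SE : 2 * S + h = h * h by rewrite SE; case: (h) => [|a] //=; nia.
(* Given these multiples of h and d, the contradiction is linear in the monomials. *)
have pqE : p + q = d.+1 + (p' + q') by lia.
have hpqE : h * (p + q) = h * (d.+1 + (p' + q')) by rewrite pqE.
have dp' : d <= d * (p' + q') by rewrite leq_pmulr ?addn_gt0 ?p'0.
have dd : 0 <= d * d by [].
lia.
Qed.

(** Once the heights agree, the size fixes p + q and the weight then fixes q. *)
Lemma terminal_word_inj {h h' p p' q q' : nat} :
  let t h p q := iota 0 h ++ nseq p h ++ nseq q h.+1 in
  0 < p -> 0 < q -> 0 < p' -> 0 < q' ->
  size (t h p q) = size (t h' p' q') ->
  weight (t h p q) = weight (t h' p' q') ->
  t h p q = t h' p' q'.
Proof.
move=> t p0 q0 p'0 q'0 szE wE.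
have hh : h = h'.
  by apply/eqP; rewrite eqn_leq (terminal_height_le p0 q'0 p'0 szE wE)
       (terminal_height_le p'0 q0 p0 (esym szE) (esym wE)).
subst h'; move: szE wE; rewrite /t /weight !size_cat !size_iota !size_nseq.
rewrite !big_cat /= !big_nseq !iter_addn_0 => szE wE.
have hE : h * (p + q) = h * (p' + q') by congr (h * _); lia.
have qE : q = q' by lia.
by rewrite -qE; have -> : p = p' by lia.
Qed.

(** * Reduction to terminal words and connectivity *)

Lemma weak_orders_of_weight_perm {n k : nat} {w w' : seq nat} :
  perm_eq w w' -> weak_orders_of_weight n k w -> weak_orders_of_weight n k w'.
Proof.
move=> ww' /weak_orders_of_weightP[sw <- [h hn wE]].
apply/weak_orders_of_weightP; split.
- by rewrite -(perm_size ww').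
- by rewrite /weight -(perm_big _ ww').
- by exists h => // v; rewrite -(perm_mem ww').
Qed.

(** As v is repeated, u still contains v and hence every letter below h. The new height is h or h -
    1 according to whether u still contains h. *)
Lemma contract_pair {h v : nat} {w : seq nat} :
  (forall x, (x \in w) = (x <= h)) -> v.+1 < h -> count_mem v w != 1 ->
  exists u h', [/\ perm_eq w [:: v, h & u], h' <= h &
                   forall x, (x \in [:: v.+1, h.-1 & u]) = (x <= h')].
Proof.
move=> wE vh v1.
have vw : v \in w by rewrite wE; lia.
have hw : h \in rem v w.
  have := wE h; rewrite leqnn (perm_mem (perm_to_rem vw)) inE.
  by case: eqP => // ?; lia.
pose u := rem h (rem v w).
have pw : perm_eq w [:: v, h & u].
  by rewrite (perm_trans (perm_to_rem vw)) // perm_cons perm_to_rem.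
have vu : v \in u.
  have := seq.permP pw (pred1 v); rewrite /= eqxx.
  have -> : (h == v) = false by lia.
  rewrite -has_pred1 has_count => E; move: v1; rewrite E.
  by case: (count _ u).
have uE x : x < h -> x \in u.
  have [->//|xv] := eqVneq x v => xh.
  have := wE x; rewrite (perm_mem pw) !inE (negPf xv).
  by rewrite (ltn_eqF xh) (ltnW xh).
have uh x : x \in u -> x <= h.
  by rewrite -wE (perm_mem pw) !inE => ->; rewrite !orbT.
have [hu|hu] := boolP (h \in u).
- exists u, h; split=> // x; rewrite !inE; apply/idP/idP.
    by case/or3P => [/eqP->|/eqP->|/uh//]; lia.
  by rewrite leq_eqVlt => /orP[/eqP->|/uE ->]; rewrite ?hu !orbT.
- exists u, h.-1; split=> //; first lia.
  move=> x; rewrite !inE; apply/idP/idP.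
    case/or3P => [/eqP->|/eqP->|xu]; [lia|lia|].
    have := uh x xu; have : x != h by apply: contraNneq hu => <-.
    by lia.
  by move=> xh; rewrite uE ?orbT //; lia.
Qed.

Lemma terminal_representative {n k : nat} {P : seq nat -> bool} :
  0 < k ->
  (forall w w', weak_orders_of_weight n k w -> perm_eq w w' -> P w = P w') ->
  (forall x y x' y' u, weak_orders_of_weight n k [:: x, y & u] ->
     weak_orders_of_weight n k [:: x', y' & u] ->
     P [:: x, y & u] = P [:: x', y' & u]) ->
  forall w, weak_orders_of_weight n k w ->
  exists h p q, let t := iota 0 h ++ nseq p h ++ nseq q h.+1 in
    [/\ 0 < p, 0 < q, size t = n, weight t = k & P w = P t].
Proof.
move=> k0 Pperm Ppair w; have [N] := ubnP (\sum_(x <- w) x ^ 2).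
elim: N w => // N IHN w wN Vw.
have [sw ww [h hn wE]] := weak_orders_of_weightP.1 Vw.
case: h hn wE => [|h] hn wE.
  (* Positive weight excludes height 0, so two top heights exist. *)
  move: k0; rewrite -ww /weight big_seq big1 // => x.
  by rewrite wE leqn0 => /eqP.
case: (pselect (forall v, v < h -> count_mem v w = 1)) => [w1|].
  have pw := terminal_perm wE w1.
  have /weak_orders_of_weightP[tn tk _] := weak_orders_of_weight_perm pw Vw.
  exists h, (count_mem h w), (count_mem h.+1 w); split=> //.
  - by rewrite -has_count has_pred1 wE leqnSn.
  - by rewrite -has_count has_pred1 wE.
  - exact: Pperm.
case/existsNP => v /not_implyP[vh /eqP v1].
have [u [h' [pw h'h uE]]] := contract_pair wE vh v1.
have Vu := weak_orders_of_weight_perm pw Vw.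
have Vu' : weak_orders_of_weight n k [:: v.+1, h.+1.-1 & u].
  have [<- <- _] := weak_orders_of_weightP.1 Vu.
  apply/weak_orders_of_weightP; split=> //.
    by rewrite /weight !big_cons /=; lia.
  by exists h' => //; move: (perm_size pw) => /=; lia.
(* The sum of squares drops by 2 * (h - v), which is positive. *)
have [|h0 [p [q [p0 q0 tn tk E]]]] := IHN _ _ Vu'.
  by move: wN; rewrite (perm_big _ pw) !big_cons /=; nia.
exists h0, p, q; split=> //; rewrite -E (Pperm _ _ Vw pw).
exact: Ppair.
Qed.

Lemma take_behead_rot1 {T : Type} {m : nat} {w : seq T} :
  size w = m.+2 -> take m (behead w) = take m (rot 1 w).
Proof.
by case: w => //= x w [sw]; rewrite rot1_cons -cats1 takel_cat // sw.
Qed.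

(** Connectivity is phrased through Boolean invariants, so that no path between words has to be
    built. *)
Lemma overlap_invariant_const {m k : nat} {P : seq nat -> bool} :
  0 < k ->
  (forall w w', weak_orders_of_weight m.+2 k w ->
     weak_orders_of_weight m.+2 k w' ->
     take m (behead w) = take m w' -> P w = P w') ->
  forall w w', weak_orders_of_weight m.+2 k w ->
    weak_orders_of_weight m.+2 k w' -> P w = P w'.
Proof.
move=> k0 Pstep.
have Prot1 w : weak_orders_of_weight m.+2 k w -> P w = P (rot 1 w).
  move=> Vw; apply: Pstep => //.
    by apply: weak_orders_of_weight_perm Vw; rewrite perm_sym perm_rot.
  by have [sw _ _] := weak_orders_of_weightP.1 Vw; apply: take_behead_rot1.
have Prot i w : weak_orders_of_weight m.+2 k w -> P w = P (rot i w).
  move=> Vw; elim: i => [|i IHi]; first by rewrite rot0.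
  have [iw|wi] := ltnP i (size w); last by rewrite rot_oversize // ltnW.
  rewrite rotS // -Prot1 //.
  by apply: weak_orders_of_weight_perm Vw; rewrite perm_sym perm_rot.
have Ppair x y x' y' u : weak_orders_of_weight m.+2 k [:: x, y & u] ->
     weak_orders_of_weight m.+2 k [:: x', y' & u] ->
     P [:: x, y & u] = P [:: x', y' & u].
  move=> V V'; have [[su] _ _] := weak_orders_of_weightP.1 V.
  have [[su'] _ _] := weak_orders_of_weightP.1 V'.
  (* The rotations y u x and u x' y' overlap in u, which has m letters. *)
  rewrite (Prot 1 _ V) (Prot 2 _ V'); apply: Pstep.
  - by apply: weak_orders_of_weight_perm V; rewrite perm_sym perm_rot.
  - by apply: weak_orders_of_weight_perm V'; rewrite perm_sym perm_rot.
  - by rewrite /rot /= drop0 !takel_cat ?su // ?drop0.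
have Pperm w w' : weak_orders_of_weight m.+2 k w -> perm_eq w w' -> P w = P w'.
  move=> Vw ww'; have Vw' := weak_orders_of_weight_perm ww' Vw.
  (* Cutting [P] off outside the weak orders makes swap invariance meaningful for all words. *)
  pose Q w := `[< weak_orders_of_weight m.+2 k w >] && P w.
  suff : Q w = Q w' by rewrite /Q !asboolT.
  apply: adjacent_swap_invariant ww' => a x y b; rewrite /Q.
  have pab : perm_eq (a ++ [:: x, y & b]) (a ++ [:: y, x & b]).
    by rewrite perm_cat2l (perm_catCA [:: x] [:: y]).
  have [V|nV] := pselect (weak_orders_of_weight m.+2 k (a ++ [:: x, y & b])).
    have V' := weak_orders_of_weight_perm pab V.
    (* Rotating the swapped pair to the front reduces the swap to [Ppair]. *)
    rewrite !asboolT // (Prot (size a) _ V) (Prot (size a) _ V').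
    rewrite !rot_size_cat /=.
    apply: Ppair; [move: V|move: V'];
      by apply: weak_orders_of_weight_perm; apply/permPl/perm_catC.
  rewrite !asboolF // => V'; apply: nV; move: V'.
  by apply: weak_orders_of_weight_perm; rewrite perm_sym.
move=> w w' Vw Vw'.
have [h [p [q [p0 q0 sz wt ->]]]] := terminal_representative k0 Pperm Ppair _ Vw.
have [h' [p' [q' [p'0 q'0 sz' wt' ->]]]] :=
  terminal_representative k0 Pperm Ppair _ Vw'.
by congr P; apply: terminal_word_inj => //; rewrite ?sz ?wt.
Qed.

(** * Merging the cycles of a permutation *)

Lemma single_cycle_perm {T : finType} {V : eqType} {hd tl : T -> V}
    {s0 : {perm T}} :
  (forall x, hd x = tl (s0 x)) ->
  (forall P : T -> bool, (forall x y, hd x = tl y -> P x = P y) ->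
     forall x y, P x = P y) ->
  exists s : {perm T},
    (forall x, hd x = tl (s x)) /\ forall x y, y \in porbit s x.
Proof.
move=> s0P conn.
pose good (s : {perm T}) := [forall x, hd x == tl (s x)].
have good0 : good s0 by apply/forallP => x; apply/eqP.
case: (arg_minnP (fun s : {perm T} => #|porbits s|) good0) => s gs smin.
have sP x : hd x = tl (s x) by apply/eqP; move: x; apply/forallP.
exists s; split=> // x y.
(* Connectivity is applied to the indicator of the orbit of x: it suffices that joined u and v are
   never separated by it. *)
rewrite -(conn (fun z => z \in porbit s x) _ x y) ?porbit_id // => u v uv.
apply/eqP; apply: contraT => neq; pose v' := (s^-1)%g v.
have sv' : s v' = v by rewrite permKV.
have uNv' : u \notin porbit s v'.
  apply: contra neq; rewrite -eq_porbit_mem => /eqP uv'.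
  rewrite porbit_sym uv' porbit_sym [in X in _ == X]porbit_sym -sv'.
  have /eqP -> : porbit s (s v') == porbit s v'.
    by rewrite eq_porbit_mem; apply: (mem_porbit s 1).
  by rewrite [in X in _ == X]porbit_sym.
(* The new permutation sends u to v and v' to s u; the latter is allowed since hd v' = tl v = hd
   u. *)
have good' : good (tperm u v' * s)%g.
  apply/forallP => z; rewrite permM -sP; apply/eqP.
  by case: tpermP => // ->; rewrite (sP v') sv' uv.
(* As u and v' lie in different orbits, the transposition lowers the number of cycles by one. *)
have := porbits_mul_tperm s u v'; rewrite uNv' /=.
have -> : u != v' by apply: contraNneq uNv' => ->; apply: porbit_id.
move=> E; have := smin _ good'; rewrite leqNgt => /negP[].
by move: E; rewrite addn1 addn2 => -[<-].
Qed.

(** * Reading the ucycle off a single cycle of words *)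

Lemma word_prefix_inj {n k : nat} {w w' : seq nat} :
  weak_orders_of_weight n.+1 k w -> weak_orders_of_weight n.+1 k w' ->
  word_prefix w = word_prefix w' -> w = w'.
Proof.
move=> /weak_orders_of_weightP[sw ww _] /weak_orders_of_weightP[sw' ww' _].
rewrite /word_prefix sw sw' /=.
case/lastP: w sw ww => // u x; rewrite size_rcons => -[su] wu.
case/lastP: w' sw' ww' => // u' x'; rewrite size_rcons => -[su'] wu'.
rewrite -!cats1 !takel_cat ?su ?su' // !take_oversize ?su ?su' // => uu'.
move: wu; rewrite -wu' uu' /weight -!cats1 !big_cat /= !big_seq1 => /addnI.
by move->.
Qed.

(** All letters are below n, so the words are found among the n-tuples over ['I_n]. *)
Lemma weak_orders_of_weight_finite (n k : nat) :
  exists s : seq (seq nat), forall w, w \in s <-> weak_orders_of_weight n k w.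
Proof.
exists [seq w <- [seq map val (t : seq 'I_n) | t : n.-tuple 'I_n] |
         `[< weak_orders_of_weight n k w >]] => w.
rewrite mem_filter; split=> [/andP[/asboolP]//|Vw].
rewrite asboolT //=; have [sw _ [h hn wE]] := weak_orders_of_weightP.1 Vw.
have wn : all (gtn n) w by apply/allP => x; rewrite wE /= => /leq_ltn_trans->.
have st : size (pmap insub w : seq 'I_n) == n.
  by rewrite size_pmap_sub -sw -all_count sw.
apply/mapP; exists (Tuple st); first exact: mem_enum.
rewrite /= (pmap_filter (insubK _)) (eq_filter (isSome_insub _)).
exact/esym/all_filterP.
Qed.

(** Each application of [f] shifts the word one place left, so letter j reaches the front after j of
    them. *)
Lemma nth_iter_overlap {T : Type} {m : nat} {f : T -> T} {word : T -> seq nat} :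
  (forall x, take m (behead (word x)) = take m (word (f x))) ->
  forall j x, j <= m -> nth 0 (word x) j = nth 0 (word (iter j f x)) 0.
Proof.
move=> fP; elim=> [//|j IHj] x jm.
by rewrite iterSr -IHj ?(ltnW jm) // -nth_behead -(nth_take _ jm) fP nth_take.
Qed.

Theorem theorem3p3 (n k : nat) (hn : 0 < n) (hk : 0 < k)
    (hkn : k <= 'C(n, 2)) :
  exists a : seq nat, ucycle_for n.-1 (weak_order_prefixes n k) a.
Proof.
(* For n = 1 the binomial coefficient is 0, below k. *)
case: n hn hkn => [//|[|m]] _ hkn; first by move: hkn; rewrite leqNgt hk.
have [S SP] := weak_orders_of_weight_finite m.+2 k.
have [[w0 Vw0]|noV] := pselect (exists w, weak_orders_of_weight m.+2 k w);
  last first.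
  (* An empty set of prefixes has the empty ucycle. *)
  have E : weak_order_prefixes m.+2 k = set0.
    by apply/seteqP; split=> // c [w Vw _]; apply: noV; exists w.
  by exists [::]; rewrite /ucycle_for E II0; split=> //; exact: card_eqxx.
pose T : finType := seq_sub S.
have V (x : T) : weak_orders_of_weight m.+2 k (val x) by apply/SP/valP.
have rotS (x : T) : rot 1 (val x) \in S.
  apply/SP; apply: weak_orders_of_weight_perm (V x).
  by rewrite perm_sym perm_rot.
pose r (x : T) : T := insubd x (rot 1 (val x)).
have valr x : val (r x) = rot 1 (val x) by rewrite insubdK //; apply: rotS.
have r_inj : injective r.
  by move=> x y /(congr1 val); rewrite !valr => /rot_inj/val_inj.
pose hd (x : T) := take m (behead (val x)); pose tl (x : T) := take m (val x).
have rP x : hd x = tl (perm r_inj x).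
  rewrite /hd /tl permE valr.
  by have [sx _ _] := weak_orders_of_weightP.1 (V x); apply: take_behead_rot1.
have conn (P : T -> bool) : (forall x y, hd x = tl y -> P x = P y) ->
    forall x y, P x = P y.
  move=> Pstep x y.
  (* The value off [S] is arbitrary: only words in [S] are compared. *)
  pose Q w := if insub w is Some z then P z else false.
  have QV z : Q (val z) = P z by rewrite /Q valK.
  rewrite -(QV x) -(QV y).
  apply: (@overlap_invariant_const m k Q) => //.
  move=> w w' /SP wS /SP w'S.
  rewrite -[w](SubK T wS) -[w'](SubK T w'S) !QV; exact: Pstep.
have [s [sP sC]] := single_cycle_perm rP conn.
pose x0 : T := Sub w0 ((SP w0).2 Vw0).
have NE : #|porbit s x0| = #|T| by apply: eq_card => y; rewrite sC.
have N0 : 0 < #|T| by apply/card_gt0P; exists x0.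
have iterN : iter #|T| s x0 = x0 by rewrite -NE iter_porbit.
have iter_surj z : exists2 i, i < #|T| & iter i s x0 = z.
  have := sC x0 z; rewrite porbit_traject NE => /trajectP[i iN ->].
  by exists i.
have iter_inj i j : i < #|T| -> j < #|T| -> iter i s x0 = iter j s x0 -> i = j.
  move=> iN jN; have := uniq_traject_porbit s x0; rewrite NE.
  move/uniqP => /(_ x0) U E; apply: U; rewrite ?inE ?size_traject //.
  by rewrite !nth_traject.
have iter_mod i : iter (i %% #|T|) s x0 = iter i s x0.
  rewrite [in RHS](divn_eq i #|T|) addnC iterD; congr iter.
  by elim: (i %/ _) => // q IHq; rewrite mulSn iterD -IHq iterN.
(* The ucycle lists the first letters of the words met along the cycle. *)
pose a := mkseq (fun i => nth 0 (val (iter i s x0)) 0) #|T|.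
have sa : size a = #|T| by rewrite size_mkseq.
(* The subword at position i starts at index i + 1, hence the shifted iterate. *)
have aE i : cyclic_subword m.+1 a i = word_prefix (val (iter i.+1 s x0)).
  have [sx _ _] := weak_orders_of_weightP.1 (V (iter i.+1 s x0)).
  rewrite /cyclic_subword /word_prefix sx /=.
  apply: (@eq_from_nth _ 0) => [|j]; rewrite size_mkseq.
    by rewrite size_takel // sx.
  move=> jm; rewrite nth_mkseq // nth_take // (nth_iter_overlap sP) //.
  by rewrite sa nth_mkseq ?ltn_mod // iter_mod -iterSr -iterD addnC.
pose g i := word_prefix (val (iter i s x0)).
have g_inj i j : i < #|T| -> j < #|T| -> g i = g j -> i = j.
  by move=> iN jN /(word_prefix_inj (V _) (V _))/val_inj; apply: iter_inj.
have gE : weak_order_prefixes m.+2 k = (g @` `I_#|T|)%classic.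
  apply/seteqP; split=> c.
    case=> w Vw <-; have [i iN iE] := iter_surj (Sub w ((SP w).2 Vw)).
    by exists i => //; rewrite /g iE SubK.
  by case=> i _ <-; exists (val (iter i s x0)) => //; apply: V.
exists a; split.
  rewrite gE sa; apply: inj_card_eq => i j.
  by rewrite !inE; apply: g_inj.
move=> c; case=> w Vw <-.
pose z : T := Sub w ((SP w).2 Vw).
(* Because of that shift, the position of z is the index of its predecessor. *)
have [i iN iE] := iter_surj ((s^-1)%g z).
exists i; split; first by rewrite sa aE /= iE permKV SubK.
move=> j [jN]; rewrite aE /= => jE; rewrite sa in jN.
apply: iter_inj => //; rewrite iE; apply: (@perm_inj _ s); rewrite permKV.
by apply/val_inj; rewrite SubK (word_prefix_inj (V _) Vw jE).
Qed.
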